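(* Suppose that $S\subseteq\{0,1\}^n$ and $\|\cdot\|$ is the $L_p$ norm with $p\ge1$. Then $S\cap\hat Z_1$ equals the set of all $x\in S$ for which there exist $\nu,\gamma\in\mathbb{R}$, $z\in\mathbb{R}^N$, $w\in[0,1]^n$ such that $$\begin{aligned} &\delta\nu-\epsilon\gamma\le\frac1N\sum_{j\in[N]}z_j,\\ &(x,w,-z_j-\gamma)\in\mathrm{conv}(\Pi_{ij}),&&\forall i\in[I],\ j\in[N],\\ &z_j\le0,&&\forall j\in[N],\\ &(x,\nu)\in\mathrm{conv}(\Pi_0),\\ &w_l+x_l=1,&&\forall l\in[n],\\ &\nu\ge1,\ \gamma\ge0, \end{aligned}$$ where $$\Pi_{ij}=\left\{(x,w,\phi):\ -\max\left\{r_{ij}^\top x+t_{ij}^\top w+u_{ij},\,0\right\}\le\phi,\ x,w\in\{0,1\}^n\right\},\quad i\in[I],\ j\in[N],$$ $$\Pi_0=\left\{(x,\phi):\ \left\|\begin{pmatrix}\eta_1x\\ \eta_2\end{pmatrix}\right\|_*\le\phi,\ x\in\{0,1\}^n\right\},$$ and the convex hulls $\{\mathrm{conv}(\Pi_{ij})\}_{i\in[I],j\in[N]}$ and $\mathrm{conv}(\Pi_0)$ are described by the corresponding systems of extended polymatroid inequalities.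
   Context: Let $n,I,N$ be positive integers, $[R]:=\{1,\dots,R\}$, $\epsilon\in(0,1)$, $\delta>0$. Let $\eta_1,\eta_2\in\{0,1\}$ with $\eta_1+\eta_2\ge1$; for each $i\in[I]$ let $B_i\in\mathbb{R}^n$, $b^i\in\mathbb{R}$, and for each $i\in[I]$, $j\in[N]$ let $\zeta_i^j\in\mathbb{R}^{n+1}$ be a given sample vector. $\|\cdot\|_*$ denotes the dual norm of the $L_p$ norm $\|\cdot\|$, i.e. the $L_q$ norm on $\mathbb{R}^{n+1}$ with $1/p+1/q=1$ ($q=\infty$ if $p=1$). For $l\in[n]$, $i\in[I]$, $j\in[N]$, with $\mathbb{I}(\cdot)$ the $0/1$ indicator, define $r_{ij},t_{ij}\in\mathbb{R}^n_+$ and $u_{ij}\in\mathbb{R}$ by $$\begin{aligned} r_{ijl}&=B_{il}\mathbb{I}(B_{il}>0)-\eta_1\zeta_{il}^j\mathbb{I}(\zeta_{il}^j<0),\\ t_{ijl}&=-B_{il}\mathbb{I}(B_{il}<0)+\eta_1\zeta_{il}^j\mathbb{I}(\zeta_{il}^j>0),\\ u_{ij}&=b^i-\eta_2\zeta_{i(n+1)}^j+\sum_{\tau\in[n]}\left(B_{i\tau}\mathbb{I}(B_{i\tau}<0)-\eta_1\zeta_{i\tau}^j\mathbb{I}(\zeta_{i\tau}^j>0)\right). \end{aligned}$$ $S\cap\hat Z_1$ is the set of all $x\in S$ for which there exist $\nu,\gamma\in\mathbb{R}$, $z\in\mathbb{R}^N$ and $w\in\{0,1\}^n$ such that $$\begin{aligned}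 &\delta\nu-\epsilon\gamma\le\frac1N\sum_{j\in[N]}z_j,\\ &-\max\left\{r_{ij}^\top x+t_{ij}^\top w+u_{ij},\,0\right\}\le-z_j-\gamma,&&\forall i\in[I],\ j\in[N],\\ &z_j\le0,&&\forall j\in[N],\\ &\left\|\begin{pmatrix}\eta_1x\\ \eta_2\end{pmatrix}\right\|_*\le\nu,\\ &w_l+x_l=1,&&\forall l\in[n],\\ &\nu\ge1,\ \gamma\ge0. \end{aligned}$$ Extended polymatroid inequalities (EPI): for a function $f:\{0,1\}^m\to\mathbb{R}$ with epigraph $\Pi_f=\{(v,\phi):\phi\ge f(v),\ v\in\{0,1\}^m\}$, saying that $\mathrm{conv}(\Pi_f)$ is described by the system of EPI means $$\mathrm{conv}(\Pi_f)=\left\{(v,\phi):\ f(0)+\sum_{l\in[m]}\rho_{\sigma_l}v_{\sigma_l}\le\phi\ \ \forall\sigma\in\Omega,\ v\in[0,1]^m\right\},$$ where $\Omega$ is the set of all permutations of $[m]$, $A_0^\sigma=\emptyset$, $A_l^\sigma=\{\sigma_1,\dots,\sigma_l\}$, $\rho_{\sigma_l}=f(e_{A_l^\sigma})-f(e_{A_{l-1}^\sigma})$, and $e_T\in\{0,1\}^m$ is the indicator vector of $T\subseteq[m]$. For $\Pi_{ij}$ the function is $(x,w)\mapsto-\max\{r_{ij}^\top x+t_{ij}^\top w+u_{ij},0\}$ on $\{0,1\}^{2n}$; for $\Pi_0$ it is $x\mapsto\left\|\begin{pmatrix}\eta_1x\\ \eta_2\end{pmatrix}\right\|_*$ on $\{0,1\}^n$.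 *)

(* Defs.v *)
From HB Require Import structures.
From mathcomp Require Import all_boot all_order all_algebra all_fingroup.
From mathcomp Require Import all_classical all_reals all_analysis.
From mathcomp Require Import ring.
Set Implicit Arguments.
Unset Strict Implicit.
Unset Printing Implicit Defensive.
Import Order.TTheory GRing.Theory Num.Theory.
Local Open Scope ring_scope.

Definition dotv (R : realType) (m : nat) (u v : 'rV[R]_m) : R :=
  \sum_(i < m) u 0 i * v 0 i.

(* Covers 1 <= p <= +oo; the value at -oo is a dummy. *)
Definition lp_norm (R : realType) (p : \bar R) (m : nat) (v : 'rV[R]_m) : R :=
  match p with
  | r%:E => (\sum_(i < m) `|v 0 i| `^ r) `^ r^-1
  | +oo%E => \big[Num.max/0]_(i < m) `|v 0 i|
  | -oo%E => 0
  end.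
Arguments lp_norm {R} p {m} v.

Definition dual_norm (R : realType) (m : nat) (nrm : 'rV[R]_m -> R)
    (v : 'rV[R]_m) : R :=
  sup [set dotv v y | y in [set y | nrm y <= 1]]%classic.

Lemma dual_norm_attained (R : realType) (m : nat) (nrm : 'rV[R]_m -> R) v M :
  (forall y, nrm y <= 1 -> dotv v y <= M) ->
  (exists2 y, nrm y <= 1 & dotv v y = M) -> dual_norm nrm v = M.
Proof.
move=> ub [y0 y01 y0M]; apply/le_anti/andP; split.
  apply: ge_sup; first by exists M, y0.
  by move=> _ [y /= y1 <-]; exact: ub.
apply: ub_le_sup; last by exists y0.
by exists M => _ [y /= y1 <-]; exact: ub.
Qed.

Lemma lp_norm1 (R : realType) (m : nat) (v : 'rV[R]_m) :
  lp_norm 1%:E v = \sum_(i < m) `|v 0 i|.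
Proof.
rewrite /lp_norm invr1 powRr1; last by apply: sumr_ge0 => i _; exact: powR_ge0.
by apply: eq_bigr => i _; rewrite powRr1.
Qed.

(* The dual norm of L_p is L_q, with 1/p + 1/q = 1. *)
Lemma dual_lp_normE (R : realType) (p : \bar R) (m : nat) (v : 'rV[R]_m) :
  (1 <= p)%E -> dual_norm (lp_norm p) v = lp_norm (hoelder_conjugate p) v.
Proof.
have dotle (y : 'rV[R]_m) : dotv v y <= \sum_(i < m) `|v 0 i| * `|y 0 i|.
  by apply: ler_sum => i _; rewrite -normrM ler_norm.
case: p => [p||] // p1; last first.
  rewrite hoelder_conjugatey -[1%E]/(1%:E) lp_norm1; apply: dual_norm_attained => [y y1|].
    apply: (le_trans (dotle y)); apply: ler_sum => i _.
    rewrite -[leRHS]mulr1 ler_wpM2l// (le_trans _ y1)//.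
    exact: (le_bigmax _ (fun i => `|y 0 i|)).
  exists (\row_i Num.sg (v 0 i)); last first.
    by apply: eq_bigr => i _; rewrite mxE mulrC -normrEsg.
  by apply: bigmax_le => // i _; rewrite mxE normr_sg lern1 leq_b1.
rewrite lee_fin in p1.
have [->|pn1] := eqVneq p 1.
  rewrite hoelder_conjugate1; apply: dual_norm_attained => [y|].
    rewrite lp_norm1 => y1; apply: (le_trans (dotle y)).
    apply: (@le_trans _ _ (\sum_(i < m) lp_norm +oo%E v * `|y 0 i|)).
      apply: ler_sum => i _; rewrite ler_wpM2r//.
      exact: (le_bigmax _ (fun i => `|v 0 i|)).
    rewrite -mulr_sumr -[leRHS]mulr1 ler_wpM2l//.
    by rewrite /lp_norm; elim/big_ind: _ => // x z x0 z0; rewrite le_max x0.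
  case: m v {dotle} => [|m] v.
    exists 0; last by rewrite /dotv /lp_norm !big_ord0.
    by rewrite lp_norm1 big_ord0.
  have [k _ /= kE] := @eq_bigmax _ R 'I_m.+1 0 ord0 predT (fun i => `|v 0 i|) isT (fun i _ => normr_ge0 _).
  exists (\row_i (Num.sg (v 0 k) * (i == k)%:R)).
    rewrite -[leLHS]/(lp_norm 1%:E _) lp_norm1 (bigD1 k)//= mxE eqxx mulr1 big1 ?addr0.
      by rewrite normr_sg lern1 leq_b1.
    by move=> i /negbTE ik; rewrite mxE ik mulr0 normr0.
  rewrite kE /dotv (bigD1 k)//= mxE eqxx mulr1 big1 ?addr0.
    by rewrite mulrC -normrEsg.
  by move=> i /negbTE ik; rewrite mxE ik !mulr0.
have p_gt1 : 1 < p by rewrite lt_neqAle eq_sym pn1.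
have p0 : 0 < p by rewrite (lt_trans _ p_gt1).
pose q := p / (p - 1).
have p10 : p - 1 != 0 by rewrite subr_eq0.
have q0 : 0 < q by rewrite divr_gt0// subr_gt0.
have -> : hoelder_conjugate p%:E = q%:E.
  by rewrite /hoelder_conjugate /= eqe gt_eqF// -EFinD inver subr_eq0 (negbTE pn1).
have pq : p^-1 + q^-1 = 1.
  by rewrite invf_div mulrBl divff ?gt_eqF// mul1r addrC subrK.
have qE : q^-1 = 1 - p^-1 by rewrite -pq addrAC subrr add0r.
rewrite {2}/lp_norm; set Q := \sum_(i < m) `|v 0 i| `^ q.
have Q0 : 0 <= Q by apply: sumr_ge0 => i _; exact: powR_ge0.
have [Qz|Qn0] := eqVneq Q 0.
  have v0 i : v 0 i = 0.
    have /eqP := Qz; rewrite psumr_eq0 => [/allP/(_ i)|? _]; last exact: powR_ge0.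
    rewrite mem_index_enum => /(_ isT) /=.
    by rewrite powR_eq0 normr_eq0 => /andP[/eqP].
  rewrite Qz powR0 ?invr_neq0 ?gt_eqF//.
  have d0 y : dotv v y = 0 by apply: big1 => i _; rewrite v0 mul0r.
  apply: dual_norm_attained => [y _|]; first by rewrite d0.
  exists 0; last exact: d0.
  rewrite /lp_norm big1 ?powR0 ?invr_neq0 ?gt_eqF// => i _.
  by rewrite mxE normr0 powR0 ?gt_eqF.
have Qp : 0 < Q by rewrite lt_neqAle eq_sym Qn0.
pose M := Q `^ q^-1.
have Mp : 0 < M by exact: powR_gt0.
have Mq : M `^ q = Q by rewrite /M -powRrM mulVf ?gt_eqF// powRr1.
apply: dual_norm_attained => [y|].
  rewrite /lp_norm => y1; apply: (le_trans (dotle y)).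
  have yp1 : \sum_(i < m) `|y 0 i| `^ p <= 1.
    rewrite leNgt; apply/negP => lt1; move: y1; apply/negP; rewrite -ltNge.
    have -> : 1 = 1 `^ p^-1 :> R by rewrite powR1.
    rewrite gt0_ltr_powR ?invr_gt0 ?nnegrE//; exact: (le_trans ler01 (ltW lt1)).
  have MV : M^-1 `^ q = Q^-1.
    by rewrite -[M^-1]powR_inv1 ?ltW// powRAC Mq powR_inv1.
  rewrite -/M -[M]mulr1 -ler_pdivrMl//.
  rewrite mulr_sumr.
  apply: (@le_trans _ _ (\sum_(i < m) (`|v 0 i| `^ q / Q / q + `|y 0 i| `^ p / p))).
    apply: ler_sum => i _; rewrite mulrA.
    have := @conjugate_powR _ (M^-1 * `|v 0 i|) `|y 0 i| q p.
    rewrite mulr_ge0 ?invr_ge0 ?(ltW Mp)// normr_ge0 => /(_ isT isT q0 p0).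
    rewrite addrC pq => /(_ erefl); rewrite powRM ?invr_ge0 ?(ltW Mp)//.
    by rewrite MV [Q^-1 * _]mulrC.
  rewrite big_split /= -!mulr_suml -/Q divff// mul1r -pq addrC lerD2r.
  by rewrite ler_piMl ?invr_ge0 ?(ltW p0).
exists (\row_i (Num.sg (v 0 i) * (`|v 0 i| `^ (q - 1) * Q `^ (- p^-1)))).
  have qp : (q - 1) * p = q.
    by rewrite /q mulrBl mul1r; field; rewrite p10.
  rewrite /lp_norm (eq_bigr (fun i => `|v 0 i| `^ q * Q^-1)) => [|i _].
    by rewrite -mulr_suml divff// powR1.
  rewrite mxE normrM normr_sg; have [->|vn0] := eqVneq (v 0 i) 0.
    by rewrite mul0r normr0 !powR0 ?gt_eqF// mul0r.
  rewrite mul1r ger0_norm ?mulr_ge0 ?powR_ge0// powRM ?powR_ge0//.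
  by rewrite -!powRrM qp mulNr mulVf ?gt_eqF// powR_inv1.
rewrite /dotv (eq_bigr (fun i => `|v 0 i| `^ q * Q `^ (- p^-1))) => [|i _].
  rewrite -mulr_suml -/Q -{1}(powRr1 Q0) -powRD ?Qn0 ?implybT//.
  by rewrite qE.
rewrite mxE mulrA [v 0 i * _]mulrC -normrEsg mulrA.
have [->|vn0] := eqVneq (v 0 i) 0.
  by rewrite normr0 mul0r !powR0 ?gt_eqF// mul0r.
rewrite -{1}[`|_|]powRr1// -powRD ?normr_eq0 ?vn0 ?implybT//.
by rewrite addrC subrK.
Qed.

Definition binary (R : realType) (m : nat) : set 'rV[R]_m :=
  [set v | forall l, v 0 l = 0 \/ v 0 l = 1]%classic.
Arguments binary {R m}.

Definition unit_box (R : realType) (m : nat) : set 'rV[R]_m :=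
  [set v | forall l, 0 <= v 0 l <= 1]%classic.

Definition conv_hull (R : realType) (E : lmodType R) (A : set E) : set E :=
  smallest (@convex_set R E) A.

(* Only the values of f on {0,1}^m matter, here and in [epi_system]. *)
Definition epigraph (R : realType) (m : nat) (f : 'rV[R]_m -> R)
    : set ('rV[R]_m * R) :=
  [set vphi : 'rV[R]_m * R | f vphi.1 <= vphi.2 /\ binary vphi.1]%classic.

Definition indic_vec (R : realType) (m : nat) (T : {set 'I_m}) : 'rV[R]_m :=
  \row_i (i \in T)%:R.

Definition prefix_set (m : nat) (sigma : 'S_m) (k : nat) : {set 'I_m} :=
  (sigma @: [set l : 'I_m | (l < k)%N])%SET.

(* Positions are 0-based, so [epi_coef f sigma l] is the increment from the
   first l to the first l.+1 values of sigma. *)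
Definition epi_coef (R : realType) (m : nat) (f : 'rV[R]_m -> R)
    (sigma : 'S_m) (l : 'I_m) : R :=
  f (indic_vec R (prefix_set sigma l.+1)) - f (indic_vec R (prefix_set sigma l)).

Definition epi_system (R : realType) (m : nat) (f : 'rV[R]_m -> R)
    : set ('rV[R]_m * R) :=
  [set vphi : 'rV[R]_m * R | (forall sigma : 'S_m,
      f 0 + \sum_(l < m) epi_coef f sigma l * vphi.1 0 (sigma l) <= vphi.2)
    /\ unit_box vphi.1]%classic.

Definition described_by_epi (R : realType) (m : nat) (f : 'rV[R]_m -> R) : Prop :=
  conv_hull (epigraph f) = epi_system f.

(* In the definitions below, the first n coordinates of zeta i j are
   zeta i j 0 (lshift 1 l), and the last one is zeta i j 0 (rshift n 0). *)
Definition r_vec (R : realType) (n I N : nat) (eta1 : bool) (B : 'I_I -> 'rV[R]_n)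
    (zeta : 'I_I -> 'I_N -> 'rV[R]_(n + 1)) (i : 'I_I) (j : 'I_N) : 'rV[R]_n :=
  \row_l (B i 0 l * (B i 0 l > 0)%R%:R
    - eta1%:R * zeta i j 0 (lshift 1 l) * (zeta i j 0 (lshift 1 l) < 0)%R%:R).

Definition t_vec (R : realType) (n I N : nat) (eta1 : bool) (B : 'I_I -> 'rV[R]_n)
    (zeta : 'I_I -> 'I_N -> 'rV[R]_(n + 1)) (i : 'I_I) (j : 'I_N) : 'rV[R]_n :=
  \row_l (- B i 0 l * (B i 0 l < 0)%R%:R
    + eta1%:R * zeta i j 0 (lshift 1 l) * (zeta i j 0 (lshift 1 l) > 0)%R%:R).

Definition u_cst (R : realType) (n I N : nat) (eta1 eta2 : bool)
    (B : 'I_I -> 'rV[R]_n) (b : 'I_I -> R)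
    (zeta : 'I_I -> 'I_N -> 'rV[R]_(n + 1)) (i : 'I_I) (j : 'I_N) : R :=
  b i - eta2%:R * zeta i j 0 (rshift n 0)
  + \sum_(l < n) (B i 0 l * (B i 0 l < 0)%R%:R
    - eta1%:R * zeta i j 0 (lshift 1 l) * (zeta i j 0 (lshift 1 l) > 0)%R%:R).

(* The pair (x, w) is encoded as [row_mx x w]. *)
Definition f_ij (R : realType) (n I N : nat) (eta1 eta2 : bool)
    (B : 'I_I -> 'rV[R]_n) (b : 'I_I -> R)
    (zeta : 'I_I -> 'I_N -> 'rV[R]_(n + 1)) (i : 'I_I) (j : 'I_N)
    (xw : 'rV[R]_(n + n)) : R :=
  - Num.max (dotv (r_vec eta1 B zeta i j) (lsubmx xw)
             + dotv (t_vec eta1 B zeta i j) (rsubmx xw)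
             + u_cst eta1 eta2 B b zeta i j) 0.

Definition f_0 (R : realType) (p : \bar R) (n : nat) (eta1 eta2 : bool)
    (x : 'rV[R]_n) : R :=
  dual_norm (lp_norm p) (row_mx (eta1%:R *: x) (const_mx eta2%:R : 'rV[R]_1)).
Arguments f_0 {R} p {n} eta1 eta2 x.

Definition Zhat1 (R : realType) (p : \bar R) (n I N : nat) (eps delta : R)
    (eta1 eta2 : bool) (B : 'I_I -> 'rV[R]_n) (b : 'I_I -> R)
    (zeta : 'I_I -> 'I_N -> 'rV[R]_(n + 1)) : set 'rV[R]_n :=
  [set x | exists (nu gamma : R) (z : 'rV[R]_N) (w : 'rV[R]_n),
    binary w /\
    delta * nu - eps * gamma <= N%:R^-1 * \sum_(j < N) z 0 j /\
    (forall i j, - Num.max (dotv (r_vec eta1 B zeta i j) x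
                            + dotv (t_vec eta1 B zeta i j) w
                            + u_cst eta1 eta2 B b zeta i j) 0
                 <= - z 0 j - gamma) /\
    (forall j, z 0 j <= 0) /\
    f_0 p eta1 eta2 x <= nu /\
    (forall l, w 0 l + x 0 l = 1) /\
    1 <= nu /\ 0 <= gamma]%classic.

(* Main.v *)
Require Import Defs.
From mathcomp Require Import all_boot all_order all_algebra all_fingroup.
From mathcomp Require Import all_classical all_reals all_analysis.
From mathcomp Require Import ring lra.
Set Implicit Arguments.
Unset Strict Implicit.
Unset Printing Implicit Defensive.
Import Order.TTheory GRing.Theory Num.Theory.
Local Open Scope classical_set_scope.
Local Open Scope ring_scope.

(** The statement has two independent halves.

    The equality of the two sets of [x] only uses that taking the convex hull
    of an epigraph over {0,1}^m adds nothing above a binary point: such a point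
    is an extreme point of the unit box, so it is not a proper average of other
    points of the box ([conv_epigraph_binary]).  Since [x] is binary, so
    is [w = 1 - x], and every membership in a convex hull becomes the
    inequality that it relaxes.

    The description of the hulls by extended polymatroid inequalities is the
    theorem of Edmonds and Lovasz, valid for every submodular function
    ([submodular_described_by_epi]).  Validity of an inequality at the
    indicator of T telescopes along the prefixes A_l of sigma: intersecting
    them with T only makes marginal values larger ([epi_valid]).  Conversely,
    for the permutation that sorts v in decreasing order, v is a convex
    combination of the indicators of the prefixes, and the left-hand side of
    the corresponding inequality is the same combination of the values of the
    function, so that (v, phi) is a combination of points of the epigraph.

    It remains to see that the functions are submodular.  Both are a concave
    function of one real variable composed with an affine function whose linear
    part is nonnegative ([submodular_concave_modular]).  For [f_ij] this is how
    it is defined, with the concave function - max (s, 0).  For [f_0], the dual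
    of the L_p norm is an L_q norm, and the L_q norm of a 0/1 vector depends
    only on its number s of ones: it is s^(1/q), or min (s, 1) for q infinite
    ([lp_norm_binary]), and s is affine in x. *)

(** * Convex hulls *)

Lemma conv_hull_sub (R : realType) (E : lmodType R) (A C : set E) :
    (forall x y (t : R), C x -> C y -> 0 < t < 1 ->
      C (t *: x + (1 - t) *: y)) ->
  A `<=` C -> conv_hull A `<=` C.
Proof.
move=> Ccvx AC; apply: smallest_sub => //; apply/convex_setW.
move=> x y /set_mem Cx /set_mem Cy k k0 k1.
by apply/mem_set; apply: Ccvx => //; rewrite k0 k1.
Qed.

Lemma conv_hull_segment (R : realType) (E : lmodType R) (A : set E) x y (t : R) :
    0 <= t <= 1 -> conv_hull A x -> conv_hull A y ->
  conv_hull A (t *: x + (1 - t) *: y).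
Proof.
move=> /andP[t0 t1] Ax Ay C [Ccvx AC].
have Cx : C x by exact: Ax.
have Cy : C y by exact: Ay.
have /(_ (Itv01 t0 t1)) := Ccvx x y _ (mem_set Cx) (mem_set Cy).
by move=> /set_mem.
Qed.

(** Abel summation turns the sum into the convex combination of the [p k] with
    weights 1 - a_0, a_0 - a_1, ..., a_(m-1).  Writing it with the increments of
    [p] instead of these weights lets an induction peel off [p 0]: the rest,
    divided by a_0, is a combination of the same form. *)
Lemma conv_hull_chain (R : realType) (E : lmodType R) (A : set E) (m : nat)
    (p : nat -> E) (a : nat -> R) :
    (forall k, conv_hull A (p k)) -> (forall k, 0 <= a k) -> a 0%N <= 1 ->
    (forall k, a k.+1 <= a k) ->
  conv_hull A (p 0%N + \sum_(k < m) a k *: (p k.+1 - p k)).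
Proof.
elim: m p a => [|m IHm] p a Ap a_ge0 a0_le1 a_dec; first by rewrite big_ord0 addr0.
have a_le0 k : a k <= a 0%N.
  by elim: k => // k; exact: le_trans.
have [a00|a0n0] := eqVneq (a 0%N) 0.
  rewrite big1 ?addr0// => k _.
  have -> : a k = 0 by apply/eqP; rewrite eq_le a_ge0 andbT -a00 a_le0.
  by rewrite scale0r.
have a0_gt0 : 0 < a 0%N by rewrite lt_neqAle eq_sym a0n0 a_ge0.
have -> : p 0%N + \sum_(k < m.+1) a k *: (p k.+1 - p k) =
    a 0%N *: (p 1%N + \sum_(k < m) (a k.+1 / a 0%N) *: (p k.+2 - p k.+1))
    + (1 - a 0%N) *: p 0%N.
  rewrite big_ord_recl /= [in RHS]scalerDr [in RHS]scaler_sumr.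
  under [in RHS]eq_bigr do rewrite scalerA mulrCA divff// mulr1.
  rewrite scalerBl scale1r scalerBr.
  rewrite [RHS]addrAC addrA; congr (_ + _).
  by rewrite addrCA.
apply: conv_hull_segment => //; first by rewrite a_ge0.
apply: (IHm (fun k => p k.+1) (fun k => a k.+1 / a 0%N)) => // [k||k].
- by rewrite divr_ge0.
- by rewrite ler_pdivrMr// mul1r.
- by rewrite ler_wpM2r// invr_ge0.
Qed.

(** The hull is contained in the set of the points over the box that satisfy the
    inequality if they are binary.  That set is convex because a proper average
    of points of the box is binary only if the points coincide. *)
Lemma conv_epigraph_binary (R : realType) (m : nat) (f : 'rV[R]_m -> R) v phi :
  binary v -> conv_hull (epigraph f) (v, phi) <-> f v <= phi.
Proof.
move=> bv; split => [|fv]; last by apply: sub_gen_smallest; split.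
suff: conv_hull (epigraph f) `<=`
    [set u | unit_box u.1 /\ (binary u.1 -> f u.1 <= u.2)].
  by move=> /[apply] -[_]; apply.
apply: conv_hull_sub => [[x a] [y b] t|[x a]] /=; last first.
  move=> [/= fx bx]; split=> // l.
  by have [->|->] := bx l; rewrite lexx ler01.
move=> [xbox fx] [ybox fy] /andP[t0 t1].
split=> [l|bxy].
  rewrite !mxE; have /andP[x0 x1] := xbox l; have /andP[y0 y1] := ybox l.
  by apply/andP; split; nra.
(* Coordinatewise: 0 and 1 are extreme points of the unit interval. *)
have [xE yE] : x = t *: x + (1 - t) *: y /\ y = t *: x + (1 - t) *: y.
  split; apply/rowP => l; have /andP[x0 x1] := xbox l;
    have /andP[y0 y1] := ybox l; have := bxy l; rewrite !mxE;
    move=> [] e; rewrite e; nra.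
move: fx fy bxy; rewrite -xE {1 2}yE -xE => /[swap] fy /[swap] bx.
move=> /(_ bx) fx; have {}fy := fy bx.
have -> : f x = t * f x + (1 - t) * f x by ring.
by rewrite lerD// ler_wpM2l// ?subr_ge0 ltW.
Qed.

(** * Indicator vectors and prefix sets *)

Lemma binary_indic_vec (R : realType) (m : nat) (T : {set 'I_m}) :
  binary (indic_vec R T).
Proof. by move=> l; rewrite mxE; case: (l \in T); [right|left]. Qed.

Lemma binaryE (R : realType) (m : nat) (v : 'rV[R]_m) :
  binary v -> v = indic_vec R [set l | v 0 l == 1]%SET.
Proof.
move=> bv; apply/rowP => l; rewrite mxE inE.
by have [->|->] := bv l; rewrite ?eqxx// eq_sym oner_eq0.
Qed.

Lemma indic_vec0 (R : realType) (m : nat) : indic_vec R (@finset.set0 'I_m) = 0.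
Proof. by apply/rowP => l; rewrite !mxE inE. Qed.

Lemma mem_prefix_set (m : nat) (sigma : 'S_m) k (i : 'I_m) :
  (sigma i \in prefix_set sigma k) = (i < k)%N.
Proof. by rewrite mem_imset ?inE//; exact: perm_inj. Qed.

Lemma prefix_set0 (m : nat) (sigma : 'S_m) : prefix_set sigma 0 = finset.set0.
Proof.
by apply/finset.setP => i; rewrite -(permKV sigma i) mem_prefix_set !inE.
Qed.

Lemma prefix_set_full (m : nat) (sigma : 'S_m) : prefix_set sigma m = [set: 'I_m]%SET.
Proof.
by apply/finset.setP => i; rewrite -(permKV sigma i) mem_prefix_set ltn_ord inE.
Qed.

Lemma prefix_setS (m : nat) (sigma : 'S_m) (l : 'I_m) :
  prefix_set sigma l.+1 = (sigma l |: prefix_set sigma l)%SET.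
Proof.
apply/finset.setP => i; rewrite -(permKV sigma i) in_setU1 !mem_prefix_set.
by rewrite (inj_eq perm_inj) ltnS leq_eqVlt.
Qed.

Lemma sorting_perm (R : realType) (m : nat) (v : 'rV[R]_m) :
  exists sigma : 'S_m, forall i j : 'I_m,
    (i <= j)%N -> v 0 (sigma j) <= v 0 (sigma i).
Proof.
pose ge_v := [rel i j : 'I_m | v 0 j <= v 0 i].
have ge_v_total : total ge_v by move=> i j; exact: le_total.
have ge_v_trans : transitive ge_v by move=> j i k /= ij jk; exact: le_trans jk ij.
have /tuple_permP[sigma sE] : perm_eq (sort ge_v (ord_tuple m)) (ord_tuple m).
  by rewrite perm_sort.
exists sigma => i j ij.
have := sort_sorted ge_v_total (ord_tuple m); rewrite sE.
move=> /(sorted_leq_nth ge_v_trans) srt.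
have {}srt := srt (fun i => lexx _) i i j.
move: srt; rewrite !inE size_tuple !ltn_ord => /(_ isT isT ij).
by rewrite -!tnth_nth !tnth_mktuple !tnth_ord_tuple.
Qed.

(** * Submodular functions and extended polymatroid inequalities *)

(** Submodularity in its diminishing returns form, which is the one that the
    telescoping sums use. *)
Definition submodular (R : realType) (m : nat) (f : 'rV[R]_m -> R) : Prop :=
  forall (T U : {set 'I_m}) i, T \subset U -> i \notin U ->
    f (indic_vec R (i |: U)%SET) - f (indic_vec R U) <=
    f (indic_vec R (i |: T)%SET) - f (indic_vec R T).

(** The increments of f along the sets T :&: A_l sum to f(T) - f(0).  The l-th one
    vanishes if sigma l is not in T, and otherwise is at least the coefficient,
    which is the marginal value of the same element with respect to the larger
    set A_l. *)
Lemma epi_valid (R : realType) (m : nat) (f : 'rV[R]_m -> R) (sigma : 'S_m) v :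
    submodular f -> binary v ->
  f 0 + \sum_(l < m) epi_coef f sigma l * v 0 (sigma l) <= f v.
Proof.
move=> fsub /binaryE ->; set T := [set l | _]%SET.
pose g k := f (indic_vec R (T :&: prefix_set sigma k)%SET).
have g0 : g 0%N = f 0 by rewrite /g prefix_set0 finset.setI0 indic_vec0.
have gm : g m = f (indic_vec R T) by rewrite /g prefix_set_full finset.setIT.
rewrite -gm -lerBrDl -g0 -(telescope_sumr g (leq0n m)) big_mkord.
apply: ler_sum => l _; rewrite mxE /epi_coef /g prefix_setS.
have [lT|lNT] := boolP (sigma l \in T); rewrite ?mulr1 ?mulr0.
  have -> : (T :&: (sigma l |: prefix_set sigma l) =
      sigma l |: (T :&: prefix_set sigma l))%SET.
    by rewrite finset.setIUr (finset.setIidPr _) ?finset.sub1set.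
  by apply: fsub => //; [exact: subsetIr|rewrite mem_prefix_set ltnn].
suff -> : (T :&: (sigma l |: prefix_set sigma l) = T :&: prefix_set sigma l)%SET.
  by rewrite subrr.
rewrite finset.setIUr (_ : (T :&: [set sigma l] = finset.set0)%SET) ?finset.set0U//.
by apply/eqP; rewrite finset.setI_eq0 disjoint_sym disjoints1.
Qed.

(** The easy inclusion is validity together with the convexity of the system.
    For the other one, the inequality of a permutation that sorts v makes
    (v, phi) a combination of points of the epigraph along the chain of its
    prefixes. *)
Lemma submodular_described_by_epi (R : realType) (m : nat) (f : 'rV[R]_m -> R) :
  submodular f -> described_by_epi f.
Proof.
move=> fsub; apply/seteqP; split.
  apply: conv_hull_sub.
    move=> [x a] [y b] t [/= xepi xbox] [/= yepi ybox] /andP[t0 t1].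
    split=> [sigma|l] /=; last first.
      rewrite !mxE; have /andP[x0 x1] := xbox l; have /andP[y0 y1] := ybox l.
      by apply/andP; split; nra.
    under eq_bigr do rewrite !mxE mulrDr ![epi_coef _ _ _ * (_ * _)]mulrCA.
    rewrite big_split /= -!mulr_sumr.
    have := xepi sigma; have := yepi sigma.
    set X := \sum_(l < m) _ * x _ _; set Y := \sum_(l < m) _ * y _ _.
    by rewrite /GRing.scale /= => Yb Xa; nra.
  move=> [x a] [/= fx bx]; split=> [sigma|l] /=.
    by apply: le_trans fx; exact: epi_valid.
  by have [->|->] := bx l; rewrite lexx ler01.
move=> [v phi] [/= vepi vbox].
have [sigma v_dec] := sorting_perm v.
pose V := f 0 + \sum_(l < m) epi_coef f sigma l * v 0 (sigma l).
(* All the points of the chain are lifted by the slack phi - V, so that their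
   combination has last coordinate phi exactly. *)
pose p k := (indic_vec R (prefix_set sigma k),
  f (indic_vec R (prefix_set sigma k)) + (phi - V)) : 'rV[R]_m * R.
pose a k := if insub k is Some l then v 0 (sigma l) else 0.
have aE (l : 'I_m) : a l = v 0 (sigma l) by rewrite /a valK.
have -> : (v, phi) = p 0%N + \sum_(k < m) a k *: (p k.+1 - p k).
  have sumE (h : 'I_m -> 'rV[R]_m * R) :
      \sum_(k < m) h k = (\sum_(k < m) (h k).1, \sum_(k < m) (h k).2).
    elim/big_rec3: _ => // k y z x _ ->.
    by case: (h k).
  rewrite sumE; congr pair; last first.
    rewrite /p prefix_set0 indic_vec0 /=.
    rewrite (eq_bigr (fun l : 'I_m => epi_coef f sigma l * v 0 (sigma l))) => [|l _].
      by rewrite addrAC addrCA -/V; ring.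
    by rewrite aE /epi_coef /= /GRing.scale /=; ring.
  apply/rowP => i; rewrite -(permKV sigma i); set l := (sigma^-1)%g i.
  rewrite mxE [X in X + _]mxE mem_prefix_set ltn0 add0r summxE (bigD1 l)//= big1 => [|k kl].
    by rewrite aE !mxE !mem_prefix_set ltnSn ltnn subr0 mulr1 addr0.
  rewrite !mxE !mem_prefix_set ltnS leq_eqVlt.
  by rewrite (inj_eq val_inj) eq_sym (negbTE kl) subrr mulr0.
apply: conv_hull_chain => [k|k||k].
- apply: sub_gen_smallest; split => /=; last exact: binary_indic_vec.
  by rewrite lerDl subr_ge0; exact: vepi.
- by rewrite /a; case: insub => // l; have /andP[] := vbox (sigma l).
- by rewrite /a; case: insub => // l; have /andP[] := vbox (sigma l).
- rewrite /a; case: (insubP _ k.+1) => [l _ lE|_].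
    have km : (k < m)%N by rewrite (leq_trans _ (ltn_ord l))// lE.
    by rewrite (insubT (fun k => k < m)%N km); apply: v_dec => /=; rewrite lE.
  by case: insub => // l; have /andP[] := vbox (sigma l).
Qed.

(** * Concave functions of modular functions *)

(** The discrete form of concavity on [c, +oo[.  The bound c matters for the
    powers, which are concave on nonnegative numbers only. *)
Definition decreasing_increments (R : realType) (c : R) (h : R -> R) : Prop :=
  forall a b d, c <= a -> a <= b -> 0 <= d -> h (b + d) - h b <= h (a + d) - h a.

Lemma dotv_indic_vec (R : realType) (m : nat) (w : 'rV[R]_m) (T : {set 'I_m}) :
  dotv w (indic_vec R T) = \sum_(i in T) w 0 i.
Proof.
rewrite /dotv [RHS]big_mkcond; apply: eq_bigr => i _; rewrite mxE.
by case: (i \in T); rewrite ?mulr1 ?mulr0.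
Qed.

(** Adding an element i increases the argument of h by w_i whatever the set is,
    and the argument is larger for the larger set because w is nonnegative. *)
Lemma submodular_concave_modular (R : realType) (m : nat) (f : 'rV[R]_m -> R)
    (h : R -> R) (c : R) (w : 'rV[R]_m) :
    decreasing_increments c h -> (forall i, 0 <= w 0 i) ->
    (forall v, binary v -> f v = h (c + dotv w v)) ->
  submodular f.
Proof.
move=> hdec w_ge0 fE T U i TU iU.
have iT : i \notin T by apply: contra iU; exact: (fintype.subsetP TU).
rewrite !fE ?dotv_indic_vec; try exact: binary_indic_vec.
rewrite !finset.big_setU1//= ![w 0 i + _]addrC !addrA.
apply: hdec => //; first by rewrite lerDl sumr_ge0.
rewrite lerD2l [leRHS](big_setID T) /= (finset.setIidPr TU).
by rewrite lerDl sumr_ge0.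
Qed.

Lemma decreasing_increments_opp_max0 (R : realType) (c : R) :
  decreasing_increments c (fun s => - Num.max s 0).
Proof.
by move=> a b d _ ab d0 /=; rewrite /Num.max; do 4 case: ltP => ?; lra.
Qed.

Lemma decreasing_increments_min1 (R : realType) (c : R) :
  decreasing_increments c (fun s => Num.min s 1).
Proof.
by move=> a b d _ ab d0 /=; rewrite /Num.min; do 4 case: ltP => ?; lra.
Qed.

(** The inverse of the increasing convex function z |-> z^r is concave. *)
Lemma concave_powR_inv (R : realType) (r x y t : R) :
    1 <= r -> 0 <= x -> 0 <= y -> 0 <= t <= 1 ->
  t * x `^ r^-1 + (1 - t) * y `^ r^-1 <= (t * x + (1 - t) * y) `^ r^-1.
Proof.
move=> r1 x0 y0 /andP[t0 t1].
have r0 : r != 0 by rewrite gt_eqF// (lt_le_trans _ r1).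
have powK z : 0 <= z -> (z `^ r^-1) `^ r = z.
  by move=> z0; rewrite -powRrM mulVf// powRr1.
have powVK z : 0 <= z -> (z `^ r) `^ r^-1 = z.
  by move=> z0; rewrite -powRrM mulfV// powRr1.
have u0 : 0 <= 1 - t by rewrite subr_ge0.
have avg_ge0 : 0 <= t * x `^ r^-1 + (1 - t) * y `^ r^-1.
  by rewrite addr_ge0 ?mulr_ge0 ?powR_ge0.
rewrite -[leLHS]powVK//; apply: ge0_ler_powR.
- by rewrite invr_ge0 (le_trans ler01).
- by rewrite nnegrE powR_ge0.
- by rewrite nnegrE addr_ge0// mulr_ge0.
have := @convex_powR R r r1 (Itv01 t0 t1) (x `^ r^-1) (y `^ r^-1).
rewrite !inE /= !in_itv /= !andbT !powR_ge0 => /(_ isT isT).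
by rewrite !convRE /= !powK.
Qed.

Lemma decreasing_increments_powR_inv (R : realType) (r : R) :
  1 <= r -> decreasing_increments 0 (fun s : R => s `^ r^-1).
Proof.
move=> r1 a b d a0 ab d0.
have [s0|sn0] := eqVneq (b - a + d) 0.
  have -> : a = b by lra.
  by rewrite lexx.
have s_gt0 : 0 < b - a + d by rewrite lt_neqAle eq_sym sn0; lra.
(* Both a + d and b lie between a and b + d, with complementary weights. *)
pose t := d / (b - a + d).
have t01 : 0 <= t <= 1.
  by rewrite divr_ge0 ?(ltW s_gt0)//= ler_pdivrMr// mul1r; lra.
have u01 : 0 <= 1 - t <= 1 by lra.
have bd0 : 0 <= b + d by lra.
have := concave_powR_inv r1 bd0 a0 t01.
have := concave_powR_inv r1 bd0 a0 u01.
have -> : t * (b + d) + (1 - t) * a = a + d by rewrite /t; field.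
have -> : (1 - t) * (b + d) + (1 - (1 - t)) * a = b by rewrite /t; field.
set A := a `^ _; set D := (b + d) `^ _; nra.
Qed.

(** * The two families of functions *)

Lemma submodular_f_ij (R : realType) (n I N : nat) (eta1 eta2 : bool)
    (B : 'I_I -> 'rV[R]_n) (b : 'I_I -> R)
    (zeta : 'I_I -> 'I_N -> 'rV[R]_(n + 1)) i j :
  submodular (f_ij eta1 eta2 B b zeta i j).
Proof.
apply: (@submodular_concave_modular _ _ _ (fun s => - Num.max s 0)
  (u_cst eta1 eta2 B b zeta i j)
  (row_mx (r_vec eta1 B zeta i j) (t_vec eta1 B zeta i j))).
- exact: decreasing_increments_opp_max0.
- move=> l; case: (split_ordP l) => k ->; rewrite ?row_mxEl ?row_mxEr mxE;
    case: eta1 => /=; case: ltP => ?; case: ltP => ? /=; lra.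
- move=> v _; rewrite /f_ij addrC; congr (- Num.max (_ + _) 0).
  rewrite /dotv big_split_ord /=; congr (_ + _); apply: eq_bigr => l _.
    by rewrite row_mxEl [lsubmx _ _ _]mxE.
  by rewrite row_mxEr [rsubmx _ _ _]mxE.
Qed.

(** The L_q norm of a 0/1 vector as a function of its number s of ones; for q
    infinite, min (s, 1) tells whether there is a one and is concave in s. *)
Definition lp_profile (R : realType) (q : \bar R) (s : R) : R :=
  match q with
  | r%:E => s `^ r^-1
  | +oo%E => Num.min s 1
  | -oo%E => 0
  end.

Lemma lp_norm_binary (R : realType) (q : \bar R) (m : nat) (v : 'rV[R]_m) :
  (1 <= q)%E -> binary v -> lp_norm q v = lp_profile q (\sum_i v 0 i).
Proof.
move=> q1 bv.
have v0 i : 0 <= v 0 i by have [->|->] := bv i.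
case: q q1 => [r||]//= r1.
  rewrite lee_fin in r1; congr (_ `^ _); apply: eq_bigr => i _; rewrite ger0_norm//.
  have [->|->] := bv i; last by rewrite powR1.
  by rewrite powR0// gt_eqF// (lt_le_trans _ r1).
apply/eqP; rewrite eq_le; apply/andP; split.
  apply: bigmax_le => [|i _]; first by rewrite le_min ler01 sumr_ge0.
  rewrite ger0_norm// le_min (bigD1 i)//= lerDl sumr_ge0//=.
  by have [->|->] := bv i.
have [/existsP[i /eqP vi1]|/existsPn vn1] := boolP [exists i, v 0 i == 1].
  rewrite ge_min; apply/orP; right.
  by apply: le_trans (le_bigmax _ (fun i => `|v 0 i|) i); rewrite vi1 normr1.
rewrite big1 => [|i _]; last by have [//|/eqP] := bv i; rewrite (negbTE (vn1 i)).
rewrite ge_min; apply/orP; left.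
by elim/big_ind: _ => // x y x0 y0; rewrite le_max x0.
Qed.

(** On a binary x, the vector (eta1 x, eta2) is binary with eta2 + eta1 sum x_l
    ones. *)
Lemma submodular_f_0 (R : realType) (p : \bar R) (n : nat) (eta1 eta2 : bool) :
  (1 <= p)%E -> submodular (f_0 p eta1 eta2 : 'rV[R]_n -> R).
Proof.
move=> p1; have q1 := hoelder_conj_ge1 p1; set q := hoelder_conjugate p in q1.
apply: (@submodular_concave_modular _ _ _ (lp_profile q) eta2%:R
  (const_mx eta1%:R)).
- move: q1; case: q => [r||]// r1 a b d ca ab d0.
    by apply: decreasing_increments_powR_inv => //; apply: le_trans ca.
  exact: decreasing_increments_min1 ca ab d0.
- by move=> i; rewrite mxE.
- move=> v bv; rewrite /f_0 dual_lp_normE// lp_norm_binary// -/q.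
    congr lp_profile; rewrite big_split_ord big_ord1 /= row_mxEr mxE addrC.
    by congr (_ + _); apply: eq_bigr => l _; rewrite row_mxEl !mxE.
  move=> l; case: (split_ordP l) => k ->; rewrite ?row_mxEl ?row_mxEr !mxE.
    by case: eta1; rewrite ?mul1r ?mul0r; [exact: bv|left].
  by case: eta2; [right|left].
Qed.

Theorem corollary7 (R : realType) (n I N : nat) (eps delta : R) (p : \bar R)
    (eta1 eta2 : bool) (B : 'I_I -> 'rV[R]_n) (b : 'I_I -> R)
    (zeta : 'I_I -> 'I_N -> 'rV[R]_(n + 1)) (S : set 'rV[R]_n)
    (hn : (0 < n)%N) (hI : (0 < I)%N) (hN : (0 < N)%N)
    (heps : 0 < eps < 1) (hdelta : 0 < delta)
    (heta : (1 <= eta1 + eta2)%N)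
    (hp : (1 <= p)%E) (hS : S `<=` binary) :
  let Pi := fun i j => epigraph (f_ij eta1 eta2 B b zeta i j) in
  let Pi0 := epigraph (f_0 p eta1 eta2 : 'rV[R]_n -> R) in
  S `&` Zhat1 p eps delta eta1 eta2 B b zeta =
    [set x | S x /\
      exists (nu gamma : R) (z : 'rV[R]_N) (w : 'rV[R]_n),
        [/\ unit_box w,
            delta * nu - eps * gamma <= N%:R^-1 * \sum_(j < N) z 0 j
          & forall i j, conv_hull (Pi i j) (row_mx x w, - z 0 j - gamma)] /\
        [/\ forall j, z 0 j <= 0,
            conv_hull Pi0 (x, nu),
            forall l, w 0 l + x 0 l = 1,
            1 <= nu
          & 0 <= gamma]]
  /\ (forall i j, described_by_epi (f_ij eta1 eta2 B b zeta i j))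
  /\ described_by_epi (f_0 p eta1 eta2 : 'rV[R]_n -> R).
Proof.
move=> Pi Pi0; split; last first.
  split=> [i j|]; apply: submodular_described_by_epi.
    exact: submodular_f_ij.
  exact: submodular_f_0.
have f_ij_row i j (x w : 'rV[R]_n) : f_ij eta1 eta2 B b zeta i j (row_mx x w) =
    - Num.max (dotv (r_vec eta1 B zeta i j) x + dotv (t_vec eta1 B zeta i j) w
               + u_cst eta1 eta2 B b zeta i j) 0.
  by rewrite /f_ij row_mxKl row_mxKr.
have binary_row (x w : 'rV[R]_n) : binary x -> binary w -> binary (row_mx x w).
  move=> bx bw l; case: (split_ordP l) => k ->; rewrite ?row_mxEl ?row_mxEr.
    exact: bx.
  exact: bw.
apply/seteqP; split=> x [Sx [nu [gamma [z [w]]]]]; have bx := hS x Sx.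
  move=> [bw [delta_nu [maxz [z_le0 [nu_ge [wx [nu1 gamma0]]]]]]].
  split=> //; exists nu, gamma, z, w; split; split=> //.
  - by move=> l; have [->|->] := bw l; rewrite lexx ler01.
  - by move=> i j; apply/conv_epigraph_binary; [exact: binary_row|rewrite f_ij_row].
  - exact/conv_epigraph_binary.
move=> [[_ delta_nu maxz] [z_le0 nu_ge wx nu1 gamma0]].
have bw : binary w.
  by move=> l; have := wx l; have [->|->] := bx l => wE; [right|left]; lra.
split=> //; exists nu, gamma, z, w.
have f_ij_le i j := iffLR (conv_epigraph_binary _ _ (binary_row _ _ bx bw)) (maxz i j).
have f_0_le := iffLR (conv_epigraph_binary _ _ bx) nu_ge.
do 2![split=> //]; split=> [i j|]; first by rewrite -f_ij_row.
by do 4![split=> //].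
Qed.
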